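(* Every primitive irreducible polynomial $f\in R_1=\mathbb{Z}[z^{\pm1}]$ with $\mathsf{m}(f)>0$ is $m$-good for some positive integer $m$.
   Context: A nonzero $f\in R_1$ is primitive if the gcd of its coefficients is $1$, and irreducible if it is not a product of two non-units of $R_1$. The Mahler measure is $\mathsf{m}(f)=\int_0^1\log|f(e^{2\pi it})|\,dt$. $m$-good (for $d=1$): for a positive integer $m$, a primitive irreducible $f\in R_1$ is $m$-good if the following two conditions hold, where all sums are finitely supported and divisibility is in $R_1$. (C1) No nonzero polynomial of the form $g(z^m)$, with $g(z)=\sum_{n\in\mathbb{Z}}\varepsilon_nz^n$ and all $\varepsilon_n\in\{-2,-1,0,1,2\}$, is divisible by $f$. (C2) For every $k\in\{1,\dots,m-1\}$, any two integers $n\ne n'$, and any nonzero $g(z)=\sum_{l\in\mathbb{Z}}\varepsilon_lz^l$ with all $\varepsilon_l\in\{-1,0,1\}$, the polynomial $z^{mn+k}-z^{mn'+k}+g(z^m)$ is not divisible by $f$. *)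

(* Defs.v *)
From HB Require Import structures.
From mathcomp Require Import all_boot all_order all_algebra finmap.
From mathcomp Require Import all_classical all_reals all_analysis.
From mathcomp Require Import complex.
(* monalg's notations are incompatible with those of mathcomp-analysis. *)
From mathcomp.multinomials Require Import -(notations) monalg.

Set Implicit Arguments.
Unset Strict Implicit.
Unset Printing Implicit Defensive.

Import Order.TTheory GRing.Theory Num.Theory.

Local Open Scope fset_scope.
Local Open Scope ring_scope.

(* The ring Z[z, z^-1]: finitely supported functions int -> int with the
   convolution product.  monalg supplies the additive group, but its product
   needs a monoid of exponents in which only 1 is invertible, which excludes
   int; hence this alias with its own product. *)
Definition laurent : Type := malg int int.

HB.instance Definition _ := GRing.Zmodule.on laurent.

(* c * z ^ k *)
Definition lterm (c k : int) : laurent := mkmalgU k c.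

Definition lmul (f g : laurent) : laurent :=
  \sum_(i <- msupp f) \sum_(j <- msupp g)
     lterm (mcoeff i f * mcoeff j g) (i + j).

Section LaurentRing.
Implicit Types f g h : laurent.

Lemma lterm0 k : lterm 0 k = 0.
Proof. exact: monalgU0. Qed.

Lemma ltermD k c d : lterm (c + d) k = lterm c k + lterm d k.
Proof. exact: monalgUD. Qed.

Lemma laurentE f : f = \sum_(k <- msupp f) lterm (mcoeff k f) k.
Proof. exact: monalgE. Qed.

Lemma lmulw (d1 d2 : {fset int}) f g :
  (msupp f `<=` d1)%fset -> (msupp g `<=` d2)%fset ->
  lmul f g = \sum_(i <- d1) \sum_(j <- d2)
     lterm (mcoeff i f * mcoeff j g) (i + j).
Proof.
move=> le_d1 le_d2; rewrite /lmul (big_fset_incl _ le_d1) /=.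
  apply/eq_bigr=> k1 _; apply/big_fset_incl => // k _ /mcoeff_outdom ->.
  by rewrite mulr0 lterm0.
move=> k _ /mcoeff_outdom fk.
by rewrite big1 // => k' _; rewrite fk mul0r lterm0.
Qed.

Lemma lmulC : commutative lmul.
Proof.
move=> f g; rewrite /lmul exchange_big; apply/eq_bigr=> j _.
by apply/eq_bigr=> i _; rewrite mulrC addrC.
Qed.

Lemma lmulTg c k g :
  lmul (lterm c k) g = \sum_(j <- msupp g) lterm (c * mcoeff j g) (k + j).
Proof.
rewrite (lmulw msuppU_le (fsubset_refl _)) big_seq_fset1.
by apply/eq_bigr => j _; rewrite mcoeffUU.
Qed.

Lemma lmulTT c d k l : lmul (lterm c k) (lterm d l) = lterm (c * d) (k + l).
Proof. by rewrite (lmulw msuppU_le msuppU_le) !big_seq_fset1 !mcoeffUU. Qed.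

Lemma lmul1g : left_id (lterm 1 0) lmul.
Proof.
move=> g; rewrite lmulTg [RHS]laurentE.
by apply/eq_bigr=> k _; rewrite mul1r add0r.
Qed.

Lemma lmulDl : left_distributive lmul +%R.
Proof.
move=> f1 f2 g.
rewrite (lmulw (msuppD_le _ _) (fsubset_refl _)).
rewrite [in RHS](lmulw (fsubsetUl _ (msupp f2)) (fsubset_refl _)).
rewrite [in RHS](lmulw (fsubsetUr (msupp f1) _) (fsubset_refl _)).
rewrite -big_split /=; apply/eq_bigr=> i _.
rewrite -big_split /=; apply/eq_bigr=> j _.
by rewrite mcoeffD mulrDl ltermD.
Qed.

Lemma lmulDr : right_distributive lmul +%R.
Proof. by move=> f g h; rewrite lmulC lmulDl !(lmulC f). Qed.

Lemma lmul0g : left_zero 0 lmul.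
Proof. by move=> g; rewrite /lmul msupp0 big_seq_fset0. Qed.

Lemma lmulg0 : right_zero 0 lmul.
Proof. by move=> g; rewrite lmulC lmul0g. Qed.

Lemma lmulA : associative lmul.
Proof.
have suml (g : laurent) (s : seq int) F :
    lmul (\sum_(i <- s) F i) g = \sum_(i <- s) lmul (F i) g.
  exact: (big_morph (lmul^~ g) (fun _ _ => lmulDl _ _ _) (lmul0g _)).
have sumr (g : laurent) (s : seq int) F :
    lmul g (\sum_(i <- s) F i) = \sum_(i <- s) lmul g (F i).
  exact: (big_morph (lmul g) (fun _ _ => lmulDr _ _ _) (lmulg0 _)).
move=> f g h; rewrite (laurentE f) [LHS]suml.
rewrite [X in _ = lmul X _]suml [RHS]suml; apply/eq_bigr=> i _.
rewrite (laurentE g) [X in lmul _ X = _]suml [LHS]sumr.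
rewrite [X in _ = lmul X _]sumr [RHS]suml; apply/eq_bigr=> j _.
rewrite (laurentE h) [X in lmul _ X = _]sumr [LHS]sumr [RHS]sumr.
by apply/eq_bigr=> k _; rewrite !lmulTT mulrA addrA.
Qed.

Lemma loner_neq0 : lterm 1 0 != 0 :> laurent.
Proof. by rewrite monalgU_eq0. Qed.

End LaurentRing.

HB.instance Definition _ := GRing.Zmodule_isComNzRing.Build laurent
  lmulA lmulC lmul1g lmulDl loner_neq0.

(* g(z) |-> g(z ^ m) *)
Definition lsubst (m : nat) (g : laurent) : laurent :=
  \sum_(k <- msupp g) lterm (mcoeff k g) (m%:Z * k).

Definition leval (F : fieldType) (x : F) (f : laurent) : F :=
  \sum_(k <- msupp f) (mcoeff k f)%:~R * x ^ k.

Definition ldvd (f g : laurent) : Prop := exists h : laurent, g = f * h.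

Definition lunit (f : laurent) : Prop := exists g : laurent, f * g = 1.

Definition lprimitive (f : laurent) : Prop :=
  f <> 0 /\ \big[gcdn/0%N]_(k <- msupp f) `|mcoeff k f|%N = 1%N.

Definition lirreducible (f : laurent) : Prop :=
  f <> 0 /\ ~ exists g h : laurent, [/\ f = g * h, ~ lunit g & ~ lunit h].

(* e ^ (2 pi i t) *)
Definition circle_pt (R : realType) (t : R) : R[i] :=
  (cos (2 * pi * t) +i* sin (2 * pi * t))%C.

(* lne is the extended-real logarithm, with lne 0 = -oo. *)
Definition mahler (R : realType) (f : laurent) : \bar R :=
  (\int[@lebesgue_measure R]_(t in `[0%R, 1%R]%classic)
     lne (ComplexField.Normc.normc (leval (circle_pt t) f))%:E)%E.

Definition good_C1 (m : nat) (f : laurent) : Prop :=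
  forall g : laurent,
    (forall n : int, mcoeff n g \in [:: -2; -1; 0; 1; 2]) ->
    lsubst m g <> 0 -> ~ ldvd f (lsubst m g).

Definition good_C2 (m : nat) (f : laurent) : Prop :=
  forall (k : nat) (n n' : int) (g : laurent),
    (1 <= k <= m - 1)%N -> n <> n' -> g <> 0 ->
    (forall l : int, mcoeff l g \in [:: -1; 0; 1]) ->
    ~ ldvd f (lterm 1 (m%:Z * n + k%:Z) - lterm 1 (m%:Z * n' + k%:Z)
              + lsubst m g).

Definition m_good (m : nat) (f : laurent) : Prop := good_C1 m f /\ good_C2 m f.

(* Main.v *)
(** Let [l] be the top exponent of [f] and [a] its coefficient there.

    If [a] is not [1] or [-1], any [m] exceeding the spread of exponents of [f]
    works.  The polynomials of (C2) have leading coefficient [1] or [-1], hence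
    are not multiples of [f].  If [f * h = g(z^m)] as in (C1), then [a] is [2]
    or [-2] and [h] has leading coefficient [1] or [-1]; modulo [2] the top
    exponent of the primitive [f] drops to some [l2 < l] while that of [h] does
    not change, so [m] divides [l - l2], which is too small.

    If [a] is [1] or [-1], then [f] has a complex root [x] of modulus [> 1]:
    otherwise Jensen's formula would give Mahler measure [<= 0].  For large [m]
    the value at [y = x ^ m] of a Laurent polynomial with small coefficients is
    dominated by its leading term, which excludes (C1).  A violation of (C2)
    reads [x ^ k * u(y) = - g(y)] with coefficients in [{-1, 0, 1}], so
    [|x| ^ (k + m * i)] and [|x| ^ (m * j)] would be nearly equal, impossible
    as [k] is not a multiple of [m].

    For the inequality in Jensen's formula, [|z - w| <= |r z - w|] when
    [|z| = 1], [|w| <= 1] and [r > 1], and the average of [log |r z - w|] over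
    the translates of [z] by the [2 ^ n]-th roots of unity is
    [2 ^- n * log |(r z) ^ 2 ^ n - w ^ 2 ^ n| <= 2 ^- n * log (r ^ 2 ^ n + 1)],
    which is close to [0] for large [n] and [r] close to [1]. *)

Require Import Defs.
From mathcomp Require Import all_boot all_order all_algebra finmap.
From mathcomp Require Import all_classical all_reals all_analysis.
From mathcomp Require Import measurable_realfun complex.
From mathcomp.multinomials Require Import -(notations) monalg.
From mathcomp Require Import zify ring lra.

Set Implicit Arguments.
Unset Strict Implicit.
Unset Printing Implicit Defensive.

Import Order.TTheory GRing.Theory Num.Theory.
Import ComplexField.Normc.

Local Open Scope ring_scope.

(** * Coefficients and leading terms *)

Lemma mcoeff_lterm (c k j : int) :
  mcoeff j (lterm c k) = if k == j then c else 0.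
Proof. by rewrite mcoeffU; case: eqP => _; rewrite ?mulr1n ?mulr0n. Qed.

Lemma mcoeff_lmul (f g : laurent) (n : int) :
  mcoeff n (f * g) = \sum_(i <- msupp f) mcoeff i f * mcoeff (n - i) g.
Proof.
rewrite [X in mcoeff n X]/(lmul f g) /lmul raddf_sum /=; apply: eq_bigr => i _.
rewrite raddf_sum /=.
under eq_bigr => j _ do rewrite mcoeff_lterm.
case: (boolP (n - i \in msupp g)) => [ing|outg].
  rewrite (bigD1_seq (n - i)) ?fset_uniq //= subrKC eqxx big1 ?addr0 //.
  by move=> j; case: (i + j =P n) => // <-; rewrite addrAC subrr add0r eqxx.
rewrite (mcoeff_outdom outg) mulr0 big_seq big1 // => j jg.
by case: eqP => // E; move: outg; rewrite -E addrAC subrr add0r jg.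
Qed.

Lemma mcoeff_lsubst (m : nat) (g : laurent) (j : int) : (0 < m)%N ->
  mcoeff j (lsubst m g) = if (m%:Z %| j)%Z then mcoeff (j %/ m%:Z)%Z g else 0.
Proof.
move=> m_gt0; have m0 : m%:Z != 0 by lia.
rewrite raddf_sum /=.
under eq_bigr => k _ do rewrite mcoeff_lterm.
case: ifP => [/dvdzP[q ->]|ndvd]; last first.
  by rewrite big1 // => k _; case: eqP => // E; rewrite -E dvdz_mulr in ndvd.
rewrite mulzK //; case: (boolP (q \in msupp g)) => [qg|qg].
  rewrite (bigD1_seq q) ?fset_uniq //= mulrC eqxx big1 ?addr0 // => k /eqP kq.
  by case: eqP => // E; case: kq; apply: (mulfI m0); rewrite E mulrC.
rewrite (mcoeff_outdom qg) big_seq big1 // => k kg.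
by case: eqP => // /eqP; rewrite mulrC => /eqP/(mulIf m0) E;
  rewrite -E kg in qg.
Qed.

Lemma laurent_eq0 (f : laurent) : f = 0 <-> forall k, mcoeff k f = 0.
Proof.
split=> [-> k|f0]; first exact: mcoeff0.
by apply/malgP => k; rewrite f0 mcoeff0.
Qed.

(* Stated modulo d so that d = 0 gives leading terms in Z[z^+-1] and d = 2
   gives leading terms of the reductions mod 2. *)
Definition top_mod (d : int) (f : laurent) (l : int) : Prop :=
  ~~ (d %| mcoeff l f)%Z /\ forall k, l < k -> (d %| mcoeff k f)%Z.

Lemma top_modE (d : int) (f : laurent) :
  (exists k, ~~ (d %| mcoeff k f)%Z) -> exists l, top_mod d f l.
Proof.
case=> k0 k0P.
(* [b] bounds the support from above, so the top exponent is [b - n] for the least natural number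
   [n] satisfying [P]. *)
pose b := (\sum_(k <- msupp f) `|k|%N)%N.
have bP k : ~~ (d %| mcoeff k f)%Z -> (k <= b%:Z).
  move=> kP; have kf : k \in msupp f.
    by rewrite -mcoeff_neq0; apply: contraNneq kP => ->; rewrite dvdz0.
  rewrite /b (bigD1_seq k) ?fset_uniq //=; lia.
pose P n := ~~ (d %| mcoeff (b%:Z - n%:Z) f)%Z.
have exP : exists n, P n.
  by exists `|b%:Z - k0|%N; rewrite /P gez0_abs ?subr_ge0 ?bP // opprB subrKC.
exists (b%:Z - (ex_minn exP)%:Z); case: ex_minnP => n Pn minn; split=> // k nk.
apply: contraT => kP.
have /minn : P `|b%:Z - k|%N.
  by rewrite /P gez0_abs ?subr_ge0 ?bP // opprB subrKC.
by have := bP _ kP; lia.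
Qed.

(** In the convolution sum at [l + l'], an index [i] above [l] meets a coefficient of [f] divisible
    by [d], and an [i] below [l] is paired with an exponent of [g] above [l']. *)
Lemma top_modM (d : int) (f g : laurent) (l l' : int) :
  top_mod d f l -> top_mod d g l' ->
  (mcoeff (l + l') (f * g) = mcoeff l f * mcoeff l' g %[mod d])%Z.
Proof.
case=> [lf fd] [lg gd]; apply/eqP; rewrite eqz_mod_dvd mcoeff_lmul.
have inf : l \in msupp f.
  by rewrite -mcoeff_neq0; apply: contraNneq lf => ->; rewrite dvdz0.
rewrite (bigD1_seq l) ?fset_uniq //= [l + l' - l]addrAC subrr add0r.
rewrite addrAC subrr add0r; apply: rpred_sum => i il.
have [li|li|E] := ltgtP l i; last by rewrite E eqxx in il.
  by rewrite dvdz_mulr ?fd.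
by rewrite dvdz_mull ?gd //; lia.
Qed.

Lemma top_modM_coef (f g : laurent) (l l' : int) :
  top_mod 0 f l -> top_mod 0 g l' ->
  mcoeff (l + l') (f * g) = mcoeff l f * mcoeff l' g.
Proof. by move=> fl gl'; have := top_modM fl gl'; rewrite !modz0. Qed.

Lemma top_mod0E (f : laurent) : f <> 0 -> exists l, top_mod 0 f l.
Proof.
move=> f0; apply: top_modE; apply: contrapT => nex; apply: f0.
apply/laurent_eq0 => k; apply/eqP; rewrite -dvd0z.
by apply: contrapT => nk; apply: nex; exists k; apply/negP.
Qed.

Lemma lmul_neq0 (f g : laurent) : f * g <> 0 -> g <> 0.
Proof. by move=> fg g0; apply: fg; rewrite g0 mulr0. Qed.

(** Otherwise [2] would divide the gcd of the coefficients. So [f] has a top exponent modulo [2]. *)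
Lemma lprimitive_odd (f : laurent) :
  lprimitive f -> exists k, ~~ (2 %| mcoeff k f)%Z.
Proof.
case=> _ prim; apply: contrapT => nex.
suff : (2 %| \big[gcdn/0]_(k <- msupp f) `|mcoeff k f|)%N by rewrite prim.
apply: (big_ind (fun n => 2 %| n)%N) => // [x y x2 y2|k _].
  by rewrite dvdn_gcd x2.
have : (2 %| mcoeff k f)%Z.
  by apply: contrapT => nk; apply: nex; exists k; apply/negP.
by rewrite dvdzE.
Qed.

Lemma msupp_spread (f : laurent) :
  exists m : nat, (0 < m)%N /\
    forall k k', mcoeff k f != 0 -> mcoeff k' f != 0 -> k - k' < m%:Z.
Proof.
exists (\sum_(k <- msupp f) `|k|%N).*2.+1; split=> // k k'.
rewrite !mcoeff_neq0 => kf k'f.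
have le i : i \in msupp f -> (`|i| <= \sum_(k <- msupp f) `|k|)%N.
  by move=> ifs; rewrite (bigD1_seq i) ?fset_uniq //= leq_addr.
have := le _ kf; have := le _ k'f; lia.
Qed.

(** Keeps the two monomials of (C2) apart from the terms of [lsubst m g]. *)
Lemma ndvdz_mulD (m k : nat) (n : int) :
  (1 <= k <= m - 1)%N -> ~~ (m%:Z %| m%:Z * n + k%:Z)%Z.
Proof.
by move=> km; rewrite rpredDl ?dvdz_mulr // dvdzE /= gtnNdvd //; lia.
Qed.

Lemma mcoeff_C2 (m k : nat) (n n' : int) (g : laurent) (j : int) :
  (1 <= k <= m - 1)%N -> n <> n' ->
  (forall l : int, mcoeff l g \in [:: -1; 0; 1]) ->
  mcoeff j (lterm 1 (m%:Z * n + k%:Z) - lterm 1 (m%:Z * n' + k%:Z)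
              + lsubst m g) \in [:: -1; 0; 1].
Proof.
move=> km nn' gP; rewrite mcoeffD mcoeffB !mcoeff_lterm.
rewrite mcoeff_lsubst; last by lia.
case: (boolP (m%:Z %| j)%Z) => [/dvdzP[q ->]|_]; last first.
  by do 2! case: ifP => _; rewrite ?subrr ?addr0 ?subr0 ?sub0r.
have neq i : (m%:Z * i + k%:Z == q * m%:Z) = false.
  by apply/eqP => E; have := ndvdz_mulD i km; rewrite E dvdz_mull.
by rewrite !neq subr0 add0r.
Qed.

Lemma lterm_sub_add_lsubst_neq0 (m k : nat) (n n' : int) (g : laurent) :
  (1 <= k <= m - 1)%N -> n <> n' ->
  lterm 1 (m%:Z * n + k%:Z) - lterm 1 (m%:Z * n' + k%:Z) + lsubst m g <> 0.
Proof.
move=> km nn' /laurent_eq0/(_ (m%:Z * n + k%:Z)).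
rewrite mcoeffD mcoeffB !mcoeff_lterm mcoeff_lsubst ?eqxx; last by lia.
rewrite (negPf (ndvdz_mulD n km)) ifF //.
by apply/eqP => /addIr/mulfI E; apply: nn'; rewrite E //; lia.
Qed.

(** * Leading coefficient other than [1] and [-1] *)

Lemma m_good_of_nonunit_lead (f : laurent) (l : int) :
  lprimitive f -> top_mod 0 f l -> `|mcoeff l f|%N != 1%N ->
  exists m : nat, (0 < m)%N /\ m_good m f.
Proof.
move=> fprim fl fl1; have [m [m_gt0 spread]] := msupp_spread f.
exists m; split=> //; split.
  move=> g gP G0 [h Gfh]; have fh0 := G0; rewrite Gfh in fh0.
  have [L hL] := top_mod0E (lmul_neq0 fh0).
  have := top_modM_coef fl hL; rewrite -Gfh mcoeff_lsubst // => E.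
  have fl0 : mcoeff l f != 0 by have [] := fl; rewrite dvd0z.
  have hL0 : mcoeff L h != 0 by have [] := hL; rewrite dvd0z.
  move: E; case: ifP => [mlL E|_ /eqP]; last first.
    by rewrite eq_sym mulf_eq0 (negPf fl0) (negPf hL0).
  (* The product is a nonzero coefficient of [g], hence of modulus [1] or [2], and its factor from
     [f] is not a unit. *)
  have [fl2 hL1] : `|mcoeff l f|%N = 2%N /\ `|mcoeff L h|%N = 1%N.
    have := gP ((l + L) %/ m)%Z; rewrite E !inE => /or4P[] /eqP; nia.
  have hLodd : top_mod 2 h L.
    split=> [|k Lk]; first by lia.
    by have [_ /(_ k Lk)] := hL; rewrite dvd0z => /eqP->.
  have [l2 fl2odd] := top_modE (lprimitive_odd fprim).
  have := top_modM fl2odd hLodd; rewrite -Gfh mcoeff_lsubst //.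
  have [odd2 _] := fl2odd; have [oddL _] := hLodd.
  (* Off the multiples of [m] the coefficient is [0], yet here it is congruent modulo [2] to a
     product of two odd numbers. *)
  case: ifP => [ml2L _|_]; last first.
    move/eqP; rewrite eq_sym eqz_mod_dvd subr0 dvdzE abszM Euclid_dvdM //.
    by move: odd2 oddL; rewrite !dvdzE => /negPf -> /negPf ->.
  (* The coefficient of [f] at [l] is even and those above it vanish. *)
  have l2l : l2 < l.
    rewrite lt_neqAle; apply/andP; split.
      by apply/eqP => ll; move: odd2; rewrite ll; lia.
    rewrite leNgt; apply/negP => ll2; have [_ /(_ _ ll2)] := fl.
    by rewrite dvd0z => /eqP f2; move: odd2; rewrite f2.
  have := spread l l2 fl0; have f20 : mcoeff l2 f != 0.
    by apply: contraNneq odd2 => ->.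
  move=> /(_ f20) lt_m; case/dvdzP: mlL => q1 E1; case/dvdzP: ml2L => q2 E2.
  (* A positive multiple of [m] contradicts the bound from [spread]. *)
  have E3 : l - l2 = (q1 - q2) * m%:Z by rewrite mulrBl -E1 -E2; ring.
  have [q12|q12] := lerP q1 q2; first by nia.
  have : 1 * m%:Z <= (q1 - q2) * m%:Z by rewrite ler_wpM2r //; lia.
  by rewrite -E3 mul1r leNgt lt_m.
move=> k n n' g km nn' _ gP [h Gfh].
have := lterm_sub_add_lsubst_neq0 (g := g) km nn'; rewrite Gfh => fh0.
have [L hL] := top_mod0E (lmul_neq0 fh0).
have := mcoeff_C2 (l + L) km nn' gP; rewrite Gfh top_modM_coef //.
have fl0 : mcoeff l f != 0 by have [] := fl; rewrite dvd0z.
have hL0 : mcoeff L h != 0 by have [] := hL; rewrite dvd0z.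
by rewrite !inE => /or3P[] /eqP; nia.
Qed.

(** * Evaluation at a root of large modulus *)

Section Leval.
Context (F : fieldType) (x : F).
Implicit Types f g : laurent.

Lemma levalw (d : {fset int}) f : (msupp f `<=` d)%fset ->
  leval x f = \sum_(k <- d) (mcoeff k f)%:~R * x ^ k.
Proof.
move=> fd; rewrite /leval (big_fset_incl _ fd) // => k _ /mcoeff_outdom ->.
by rewrite mul0r.
Qed.

Lemma leval0 : leval x 0 = 0.
Proof. by rewrite /leval msupp0 big_seq_fset0. Qed.

Lemma levalD f g : leval x (f + g) = leval x f + leval x g.
Proof.
rewrite (levalw (msuppD_le _ _)).
rewrite (levalw (fsubsetUl _ (msupp g))) (levalw (fsubsetUr (msupp f) _)).
rewrite -big_split /=; apply: eq_bigr => i _.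
by rewrite mcoeffD intrD mulrDl.
Qed.

Lemma leval_sum (I : Type) (r : seq I) (G : I -> laurent) :
  leval x (\sum_(i <- r) G i) = \sum_(i <- r) leval x (G i).
Proof. exact: (big_morph _ levalD leval0). Qed.

Lemma levalB f g : leval x (f - g) = leval x f - leval x g.
Proof. by apply/eqP; rewrite eq_sym subr_eq -levalD subrK. Qed.

Lemma leval_lterm (c k : int) : leval x (lterm c k) = c%:~R * x ^ k.
Proof.
by rewrite (levalw msuppU_le) big_seq_fset1 mcoeffUU.
Qed.

Lemma levalM f g : x != 0 -> leval x (f * g) = leval x f * leval x g.
Proof.
move=> x0; rewrite {1}(laurentE f) {1}(laurentE g) mulr_suml leval_sum.
rewrite [in RHS]/leval mulr_suml; apply: eq_bigr => i _.
rewrite mulr_sumr leval_sum mulr_sumr; apply: eq_bigr => j _.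
rewrite [X in leval _ X]lmulTT leval_lterm expfzDr // intrM; ring.
Qed.

Lemma leval_lsubst (m : nat) g : leval x (lsubst m g) = leval (x ^+ m) g.
Proof.
rewrite leval_sum; apply: eq_bigr => k _.
by rewrite leval_lterm -exprz_exp.
Qed.

End Leval.

(** * Domination by the leading term *)

Section Dominance.
Context (R : realType).
Implicit Types (x : R[i]) (g : laurent).

Lemma normc_ge0 x : 0 <= normc x.
Proof. by case: x => a b; exact: sqrtr_ge0. Qed.

Lemma normcX x n : normc (x ^+ n) = normc x ^+ n.
Proof. by elim: n => [|n IH]; rewrite ?expr0 ?normc1 // !exprS normcM IH. Qed.

Lemma normcXz x (k : int) : normc (x ^ k) = normc x ^ k.
Proof. by case: k => n; rewrite ?NegzE -?exprnN -?exprnP ?normcV ?normcX. Qed.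

Lemma normc_int (z : int) : normc (z%:~R : R[i]) = `|z|%:~R.
Proof.
by case: z => n; rewrite ?NegzE ?rmorphN ?normcN ?normrN /= normcMn normc1.
Qed.

(** The bound is the full series of the [b ^ k] over [k < l]; prepending [k] to a tail turns
    [b ^ k / (b - 1)] into [b ^ (k + 1) / (b - 1)]. *)
Lemma geometric_tail (b : R) (l : int) (s : seq int) :
  1 < b -> path >%R l s -> \sum_(k <- s) b ^ k <= b ^ l / (b - 1).
Proof.
move=> b1; have b1' : 0 < b - 1 by rewrite subr_gt0.
have b0 : 0 < b by lra.
elim: s l => [|k s IH] l /=.
  by rewrite big_nil divr_ge0 ?exprz_ge0 ?ltW.
case/andP=> kl ks; rewrite big_cons.
apply: (@le_trans _ _ (b ^ k + b ^ k / (b - 1))); first by rewrite lerD2l IH.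
have -> : b ^ k + b ^ k / (b - 1) = b ^ (k + 1) / (b - 1).
  by rewrite expfzDr ?gt_eqF // expr1z; field; rewrite gt_eqF.
rewrite ler_pM2r ?invr_gt0 //; apply: ler_weXz2l; [exact: ltW|lia].
Qed.

Lemma msupp_sorted g : g <> 0 ->
  exists l s, perm_eq (l :: s) (msupp g) /\ path >%R l s.
Proof.
move=> g0; have pm : perm_eq (rev (sort <=%R (msupp g))) (msupp g).
  by rewrite perm_rev perm_sort.
have : sorted >%R (rev (sort <=%R (msupp g))).
  by rewrite rev_sorted sort_lt_sorted fset_uniq.
case: (rev _) pm => [|l s] pm gs; last by exists l, s.
case: g0; apply/laurent_eq0 => k; apply: mcoeff_outdom.
by rewrite -(perm_mem pm).
Qed.

Lemma leval_lead x g (B : int) :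
  1 < normc x -> g <> 0 -> (forall k, `|mcoeff k g| <= B) ->
  exists l, mcoeff l g != 0 /\
    normc (leval x g - (mcoeff l g)%:~R * x ^ l)
      <= B%:~R * (normc x ^ l / (normc x - 1)).
Proof.
move=> x1 g0 gB; have [l [s [pm ls]]] := msupp_sorted g0.
exists l; split; first by rewrite mcoeff_neq0 -(perm_mem pm) mem_head.
rewrite /leval -(perm_big _ pm) /= big_cons addrAC subrr add0r.
have B0 : 0 <= B := le_trans (normr_ge0 _) (gB 0).
apply: (le_trans _ (ler_wpM2l _ (geometric_tail x1 ls))); last by rewrite ler0z.
rewrite mulr_sumr; elim: {pm ls} s => [|k s IH].
  by rewrite !big_nil normc0.
rewrite !big_cons; apply: (le_trans (le_normcD _ _)); apply: lerD => //.
rewrite normcM normcXz normc_int ler_wpM2r ?ler_int //.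
by rewrite exprz_ge0 ?normc_ge0.
Qed.

End Dominance.

Lemma normcB_ge (R : realType) (y z : R[i]) :
  normc y - normc z <= normc (y - z).
Proof. by rewrite lerBlDr -{1}(subrK z y) le_normcD. Qed.

Lemma normr_mcoeff1 (g : laurent) : (forall k, mcoeff k g \in [:: -1; 0; 1]) ->
  forall k, `|mcoeff k g| <= 1.
Proof. by move=> gP k; have := gP k; rewrite !inE => /or3P[] /eqP ->. Qed.

(** With [b = normc x], the leading term has modulus [b ^ l] and the others add up to at most
    [b ^ l / (b - 1)]; everything is multiplied by [b - 1]. *)
Lemma leval_sandwich (R : realType) (x : R[i]) (g : laurent) :
  1 < normc x -> g <> 0 -> (forall k, mcoeff k g \in [:: -1; 0; 1]) ->
  exists l : int,
    normc x ^ l * (normc x - 2) <= normc (leval x g) * (normc x - 1)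
      <= normc x ^ l * normc x.
Proof.
move=> x1 g0 gP; have [l [gl]] := leval_lead x1 g0 (normr_mcoeff1 gP).
set b := normc x in x1 *; have b1 : 0 < b - 1 by rewrite subr_gt0.
have glx : normc ((mcoeff l g)%:~R * x ^ l) = b ^ l.
  rewrite normcM normcXz normc_int; have := gP l; rewrite !inE.
  by case/or3P => /eqP E; rewrite E in gl *; rewrite ?mul1r.
have := normcB_ge ((mcoeff l g)%:~R * x ^ l) (leval x g).
have := normcB_ge (leval x g) ((mcoeff l g)%:~R * x ^ l).
rewrite -(normcN (_ - leval x g)) opprB glx mul1r.
have : b ^ l / (b - 1) * (b - 1) = b ^ l by rewrite divfK // gt_eqF.
move: (b ^ l / (b - 1)) (normc (leval x g)) => q N.
move: (normc (leval x g - _)) => M qE h1 h2 h3.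
by exists l; rewrite -qE in h1 h2 *; apply/andP; split; nra.
Qed.

(** Bernoulli's inequality and the Archimedean property. *)
Lemma exprn_unbounded (R : realType) (a C : R) : 1 < a ->
  exists m : nat, (0 < m)%N /\ C < a ^+ m.
Proof.
move=> a1; have a0 : 0 < a - 1 by rewrite subr_gt0.
have bern m : 1 + m%:R * (a - 1) <= a ^+ m.
  elim: m => [|m IH]; first by rewrite mul0r addr0 expr0.
  rewrite exprS -natr1; have m0 : 0 <= m%:R :> R by [].
  have := mulr_ge0 m0 (sqr_ge0 (a - 1)).
  have : a * (1 + m%:R * (a - 1)) <= a * a ^+ m by rewrite ler_pM2l //; lra.
  by nra.
exists (Num.bound `|C / (a - 1)|).+1; split=> //.
apply: (lt_le_trans _ (bern _)).
have : C / (a - 1) < (Num.bound `|C / (a - 1)|)%:R.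
  exact: le_lt_trans (ler_norm _) (archi_boundP (normr_ge0 _)).
rewrite ltr_pdivrMr // -natr1; nra.
Qed.

Lemma m_good_of_root (R : realType) (x : R[i]) (f : laurent) :
  1 < normc x -> leval x f = 0 -> exists m : nat, (0 < m)%N /\ m_good m f.
Proof.
move=> x1 fx; set a := normc x in x1.
(* With [b = a ^+ m], the [3] gives [2 / (b - 1) < 1], as needed for coefficients up to [2] in (C1).
   The fraction gives [b < a * (b - 2)], which serves (C2). *)
have [m [m_gt0 am]] := exprn_unbounded (3 + 2 * a / (a - 1)) x1.
have a1 : 0 < a - 1 by rewrite subr_gt0.
have q0 : 0 < 2 * a / (a - 1) by rewrite divr_gt0 //; lra.
have b3 : 3 < a ^+ m by lra.
have ba : 2 * a < a ^+ m * (a - 1) by rewrite -ltr_pdivrMr //; lra.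
have x0 : x != 0 by apply: contraTneq x1 => x0; rewrite /a x0 normc0 -leNgt.
have bE : normc (x ^+ m) = a ^+ m by rewrite normcX.
exists m; split=> //; split.
  move=> g gP G0 [h Gfh].
  have gx : leval (x ^+ m) g = 0.
    by rewrite -leval_lsubst Gfh levalM // fx mul0r.
  have g0 : g <> 0.
    by move=> g0; apply: G0; rewrite g0 /lsubst msupp0 big_seq_fset0.
  have gB k : `|mcoeff k g| <= 2.
    by have := gP k; rewrite !inE => /or4P[|||/orP[]] /eqP ->.
  have b1 : 1 < normc (x ^+ m) by rewrite bE; lra.
  have [l [gl]] := leval_lead b1 g0 gB.
  rewrite gx sub0r normcN normcM normcXz normc_int bE => le.
  have bl : 0 < (a ^+ m) ^ l by rewrite exprz_gt0 //; lra.
  have gl1 : 1 <= `|mcoeff l g|%:~R :> R by rewrite -[1]/(1%:~R) ler_int; lia.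
  have : (a ^+ m) ^ l / (a ^+ m - 1) * 2 < (a ^+ m) ^ l.
    by rewrite mulrAC ltr_pdivrMr ?ltr_pM2l //; lra.
  by nra.
move=> k n n' g km nn' g0 gP [h Gfh].
pose u : laurent := lterm 1 n - lterm 1 n'.
have u0 : u <> 0.
  move/laurent_eq0/(_ n); rewrite mcoeffB !mcoeff_lterm eqxx ifF //.
  by apply/eqP => E; apply: nn'.
have uP j : mcoeff j u \in [:: -1; 0; 1].
  rewrite mcoeffB !mcoeff_lterm.
  by do 2! case: ifP => _; rewrite ?subrr ?subr0 ?sub0r.
(* Both monomials of (C2) share the factor [x ^+ k], and the whole polynomial vanishes at the root
   [x] of [f]. *)
have E : x ^+ k * leval (x ^+ m) u = - leval (x ^+ m) g.
  apply/eqP; rewrite -addr_eq0 -(leval_lsubst _ _ g); apply/eqP.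
  transitivity (leval x (f * h)); last by rewrite levalM // fx mul0r.
  rewrite -Gfh [RHS]levalD /u !levalB !leval_lterm !mul1r mulrBr.
  by rewrite !expfzDr // -!exprz_exp -!exprnP !(mulrC (x ^+ k)).
have b1 : 1 < normc (x ^+ m) by rewrite bE; lra.
have [l1] := leval_sandwich b1 u0 uP.
have [l2] := leval_sandwich b1 g0 gP.
have := congr1 (@normc R) E; rewrite normcM normcN normcX => <-; rewrite -/a.
rewrite bE; set b := a ^+ m in b3 ba bE *.
have bE' (l : int) : b ^ l = a ^ (m%:Z * l) by rewrite -exprz_exp.
move: (normc (leval _ u)) => U /andP[l2a l2b] /andP[l1a l1b].
have step (i j : int) : i < j -> a * a ^ i <= a ^ j.
  move=> ij; have -> : a * a ^ i = a ^ (i + 1).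
    by rewrite expfzDr ?expr1z 1?mulrC // gt_eqF //; lra.
  by apply: ler_weXz2l; [exact: ltW | lia].
(* Together these would give [a * (b - 2) <= b], against the choice of [m]. *)
have no_gap (A B W : R) : 0 < B -> A * (b - 2) <= W -> W <= B * b ->
    a * B <= A -> False.
  move=> B0 AW WB BA.
  have : a * B * (b - 2) <= A * (b - 2) by rewrite ler_pM2r //; lra.
  have : B * (2 * a) < B * (b * (a - 1)) by rewrite ltr_pM2l.
  by nra.
have apos (i : int) : 0 < a ^ i by rewrite exprz_gt0 //; lra.
have ak0 : 0 < a ^+ k by rewrite exprn_gt0 //; lra.
have A1E : a ^+ k * b ^ l1 = a ^ (m%:Z * l1 + k%:Z).
  by rewrite bE' expfzDr 1?mulrC // gt_eqF //; lra.
have l1a' : a ^+ k * b ^ l1 * (b - 2) <= a ^+ k * U * (b - 1).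
  by rewrite -!mulrA ler_pM2l.
have l1b' : a ^+ k * U * (b - 1) <= a ^+ k * b ^ l1 * b.
  by rewrite -!mulrA ler_pM2l.
rewrite A1E in l1a' l1b'; rewrite bE' in l2a l2b.
have := ndvdz_mulD l1 km.
(* Distinct exponents of [a] differ by a factor of at least [a], which [no_gap] forbids; equal ones
   would make [m] divide [m * l1 + k]. *)
have [lt|lt|E2] := ltgtP (m%:Z * l1 + k%:Z) (m%:Z * l2) => nd.
- exact: (no_gap _ _ _ (apos _) l2a l1b' (step _ _ lt)).
- exact: (no_gap _ _ _ (apos _) l1a' l2b (step _ _ lt)).
- by rewrite E2 dvdz_mulr in nd.
Qed.

(** Multiplying by the [K]-th power of the variable gives an ordinary polynomial [P], which splits.
    As its leading coefficient survives in [F], [P] has degree [l + K]. *)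
Lemma leval_factor (F : closedFieldType) (f : laurent) (l : int) :
  top_mod 0 f l -> (mcoeff l f)%:~R != 0 :> F ->
  exists (N : int) (s : seq F), forall x : F, x != 0 ->
    leval x f = (mcoeff l f)%:~R * x ^ N * \prod_(w <- s) (x - w).
Proof.
case=> fl0 fl fl1.
pose K : int := (\sum_(k <- msupp f) `|k|)%N%:Z.
have K_ge k : k \in msupp f -> 0 <= k + K.
  by move=> kf; rewrite /K (bigD1_seq k) ?fset_uniq //=; lia.
have le_l k : k \in msupp f -> k <= l.
  rewrite -mcoeff_neq0 => kf; rewrite leNgt; apply: contra kf => /fl.
  by rewrite dvd0z.
have lf : l \in msupp f by rewrite -mcoeff_neq0 -dvd0z.
pose P : {poly F} := \sum_(k <- msupp f) (mcoeff k f)%:~R *: 'X^(absz (k + K)).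
have Pl : P`_(absz (l + K)) = (mcoeff l f)%:~R.
  rewrite /P coef_sum (bigD1_seq l) ?fset_uniq //= coefZ coefXn eqxx mulr1.
  rewrite big_seq_cond big1 ?addr0 // => k /andP[kf kl].
  rewrite coefZ coefXn; case: eqP => [E|_]; last by rewrite mulr0.
  by move: (K_ge _ kf) (K_ge _ lf) kl E; lia.
have sP : size P = (absz (l + K)%R).+1%N.
  apply/eqP; rewrite eqn_leq; apply/andP; split; last first.
    by rewrite ltnNge; apply: contra fl1 => le; rewrite -Pl nth_default.
  apply: (leq_trans (size_sum _ _ _)); apply/bigmax_leqP_seq => k kf _.
  apply: (leq_trans (size_scale_leq _ _)); rewrite size_polyXn ltnS.
  by move: (K_ge _ kf) (le_l _ kf); lia.
have [s Ps] := closed_field_poly_normal P.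
exists (- K), s => x x0.
have -> : \prod_(w <- s) (x - w) = (\prod_(w <- s) ('X - w%:P)).[x].
  by rewrite horner_prod; apply: eq_bigr => w _; rewrite hornerXsubC.
rewrite mulrAC -Pl -[absz (l + K)]succnK -sP -lead_coefE -hornerZ -Ps.
rewrite horner_sum mulr_suml; apply: eq_big_seq => k kf.
by rewrite hornerZ hornerXn exprnP gez0_abs ?K_ge // -mulrA -expfzDr // addrK.
Qed.

(** * Jensen's inequality *)

Import numFieldNormedType.Exports.

(** * Integrals over the unit interval and averages over translates *)

Section Average.
Context (R : realType).
Implicit Types (h H : R -> R).
Notation mu := (@lebesgue_measure R).

Lemma continuous_antiderivative h (a b : R) : continuous h -> a < b ->
  exists H, forall x : R, x \in `]a, b[%R -> is_derive x 1 H (h x).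
Proof.
move=> ch ab; exists (fun x => \int[mu]_(t in `[a, x]) h t)%R => x.
rewrite in_itv /= => /andP[ax xb].
have ih : mu.-integrable `[a, b] (EFin \o h).
  apply: continuous_compact_integrable; first exact: segment_compact.
  exact: continuous_subspaceT.
have [dH H'] := continuous_FTC1_closed xb ih ax (ch x).
by apply: DeriveDef => //; rewrite -derive1E.
Qed.

(* Mean value theorem for the sum of N translates of an antiderivative of h,
   on the interval [0, 1/N]. *)
Lemma integral_01_le_average h (N : nat) (C : R) : continuous h -> (0 < N)%N ->
  (forall x, \sum_(j < N) h (x + j%:R / N%:R) <= C) ->
  (\int[mu]_(t in `[0%R, 1%R]) (h t)%:E <= (C / N%:R)%:E)%E.
Proof.
move=> ch N_gt0 hC.
have N0 : (0 : R) < N%:R by rewrite ltr0n.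
(* An open interval around [[0, 1]] makes [H] differentiable at both endpoints. *)
have [H H'] : exists H, forall x : R, x \in `]-1, 2[%R -> is_derive x 1 H (h x).
  by apply: continuous_antiderivative => //; lra.
have cH (x : R) : x \in `]-1, 2[%R -> {for x, continuous H}.
  move=> /H' dH; apply/differentiable_continuous/derivable1_diffP.
  exact: ex_derive.
rewrite (@continuous_FTC2 _ _ H) //; first last.
- move=> x; rewrite in_itv /= => /andP[x0 x1]; rewrite derive1E.
  by have -> := @derive_val _ _ _ _ _ _ _ (H' x _); rewrite // in_itv /=; lra.
- split.
  + move=> x; rewrite in_itv /= => /andP[x0 x1].
    have dH := H' x; apply: ex_derive; apply: dH; rewrite in_itv /=; lra.
  + by apply: cvg_at_right_filter; apply: cH; rewrite in_itv /=; lra.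
  + by apply: cvg_at_left_filter; apply: cH; rewrite in_itv /=; lra.
- exact: continuous_subspaceT.
rewrite -EFinB lee_fin.
pose G := \sum_(j < N) (fun x => H (x + j%:R / N%:R)).
have jN (j : 'I_N) : 0 <= (j%:R / N%:R : R) /\ j%:R / N%:R + N%:R^-1 <= 1 :> R.
  split; first by rewrite divr_ge0.
  by rewrite -{2}[N%:R^-1]mul1r -mulrDl natr1 ler_pdivrMr // mul1r ler_nat.
have shift_in (j : 'I_N) (x : R) : 0 <= x -> x <= N%:R^-1 ->
    x + j%:R / N%:R \in `]-1, 2[%R.
  by move=> x0 xN; have [j0 jN1] := jN j; rewrite in_itv /=; lra.
have GE x : G x = \sum_(j < N) H (x + j%:R / N%:R) by rewrite /G fct_sumE.
have dG (x : R) : 0 <= x -> x <= N%:R^-1 ->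
    is_derive x 1 G (\sum_(j < N) h (x + j%:R / N%:R)).
  move=> x0 xN; apply: is_derive_sum => j.
  have := H' _ (shift_in j x x0 xN).
  have ds := @is_derive_shift R x 1 (j%:R / N%:R).
  by move=> dH; have := @is_derive1_comp _ H (shift (j%:R / N%:R)) x _ _ dH ds;
    rewrite mulr1.
have [|||c _ Gc] :=
  @MVT R G (fun x => \sum_(j < N) h (x + j%:R / N%:R)) 0 N%:R^-1.
- by rewrite invr_gt0.
- by move=> x; rewrite in_itv /= => /andP[x0 xN]; apply: dG; lra.
- apply: derivable_within_continuous => x; rewrite in_itv /= => /andP[x0 xN].
  by apply: ex_derive; exact: dG.
(* The increments of [H] over the [N] intervals of length [1/N] telescope. *)
suff <- : G N%:R^-1 - G 0 = H 1 - H 0.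
  by rewrite Gc subr0 ler_pM2r ?invr_gt0.
rewrite !GE -sumrB.
transitivity (\sum_(0 <= j < N) (H (j.+1%:R / N%:R) - H (j%:R / N%:R))).
  rewrite big_mkord; apply: eq_bigr => j _.
  by rewrite -natr1 mulrDl mul1r add0r [N%:R^-1 + _]addrC.
rewrite (telescope_sumr (fun j => H (j%:R / N%:R))) //.
by rewrite mul0r divff // gt_eqF.
Qed.
End Average.

(** * Logarithmic distances from a dilated circle *)

Section Jensen.
Context (R : realType).
Implicit Types (r t : R) (z w : R[i]) (s : seq R[i]).
Notation mu := (@lebesgue_measure R).

Lemma normc_circle_pt t : normc (circle_pt t) = 1 :> R.
Proof. by rewrite /= cos2Dsin2 sqrtr1. Qed.

Lemma circle_pt_half t : circle_pt (t + 2^-1) = - circle_pt t.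
Proof.
rewrite /circle_pt mulrDr; have -> : 2 * pi * 2^-1 = pi :> R by field.
by rewrite cosDpi sinDpi.
Qed.

Lemma circle_pt_double t : circle_pt (2 * t) = circle_pt t ^+ 2.
Proof.
rewrite /circle_pt; have -> : 2 * pi * (2 * t) = (2 * pi * t) *+ 2.
  by rewrite -mulr_natl; ring.
rewrite cos_mulr2n sin_mulr2n expr2; apply/eqP; rewrite eq_complex /=.
have := cos2Dsin2 (2 * pi * t); move: (cos _) (sin _) => c s cs.
by rewrite -[X in _ - X]cs; apply/andP; split; apply/eqP; ring.
Qed.

(** The difference of the squares is [(r - 1) ^ 2 + 2 (r - 1) (1 - c)], where [c] is the inner
    product of [z] and [w], at most [1]. *)
Lemma normc_dilate_ge r z w : 1 < r -> normc z = 1 -> normc w <= 1 ->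
  normc (z - w) <= normc (r%:C%C * z - w).
Proof.
case: z w => [p q] [a b] r1 /= z1 w1.
have /(congr1 (fun u => u ^+ 2)) := z1.
rewrite sqr_sqrtr ?addr_ge0 ?sqr_ge0 // expr1n => {}z1.
have {}w1 : a ^+ 2 + b ^+ 2 <= 1.
  rewrite -[leLHS]sqr_sqrtr ?addr_ge0 ?sqr_ge0 // -(expr1n _ 2).
  by rewrite lerXn2r ?nnegrE // sqrtr_ge0.
rewrite ler_sqrt ?addr_ge0 ?sqr_ge0 //.
have : p * a + q * b <= 1.
  by have := sqr_ge0 (p - a); have := sqr_ge0 (q - b); nra.
move=> pq; have : 0 <= (r - 1) * (1 - (p * a + q * b)) by apply: mulr_ge0; lra.
have : 0 <= (r - 1) * (r - 1) by apply: mulr_ge0; lra.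
by nra.
Qed.

Lemma normc_real r : normc (r%:C%C) = `|r| :> R.
Proof. by rewrite /= expr0n addr0 sqrtr_sqr. Qed.

Lemma normc_dilate_gt0 r t w : 1 < r -> normc w <= 1 ->
  0 < normc (r%:C%C * circle_pt t - w).
Proof.
move=> r1 w1; apply: lt_le_trans (normcB_ge _ _).
by rewrite normcM normc_circle_pt normc_real mulr1 ger0_norm; lra.
Qed.

(** For [r > 1] the dilated circle avoids the closed unit disc, so for [w] in that disc the real
    logarithm is continuous in [t]. *)
Definition log_dist r w t : R := ln (normc (r%:C%C * circle_pt t - w)).

Lemma log_dist_le r w t : 1 < r -> normc w <= 1 -> log_dist r w t <= ln (r + 1).
Proof.
move=> r1 w1; rewrite ler_ln ?posrE ?normc_dilate_gt0 //; last by lra.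
apply: (le_trans (le_normcD _ _)).
by rewrite normcN normcM normc_circle_pt normc_real mulr1 ger0_norm; lra.
Qed.

(** With [z = circle_pt t], this is [(r z - w) (- r z - w) = - (r ^ 2 z ^ 2 - w ^ 2)]. *)
Lemma log_dist_double r w t : 1 < r -> normc w <= 1 ->
  log_dist r w t + log_dist r w (t + 2^-1) = log_dist (r ^+ 2) (w ^+ 2) (2 * t).
Proof.
move=> r1 w1; rewrite /log_dist -lnM ?posrE ?normc_dilate_gt0 //.
rewrite -normcM circle_pt_half circle_pt_double rmorphXn /= -normcN.
by congr (ln (normc _)); ring.
Qed.

(* The translates by t and t + 1/2 pair up as in log_dist_double, which squares
   r and w. *)
Lemma sum_log_dist_le n r w t : 1 < r -> normc w <= 1 ->
  \sum_(j < 2 ^ n) log_dist r w (t + j%:R / (2 ^ n)%:R)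
    <= ln (r ^+ (2 ^ n) + 1).
Proof.
elim: n r w t => [|n IH] r w t r1 w1.
  by rewrite expn0 expr1 big_ord1 mul0r addr0 log_dist_le.
have n0 : (2 ^ n)%:R != 0 :> R by rewrite pnatr_eq0 -lt0n expn_gt0.
have r2 : 1 < r ^+ 2 by rewrite exprn_egt1.
have w2 : normc (w ^+ 2) <= 1 by rewrite normcX expr_le1 ?normc_ge0.
have := IH _ _ (2 * t) r2 w2; rewrite -exprM -expnS; apply: le_trans.
rewrite -(big_mkord xpredT (fun j => log_dist r w (t + j%:R / (2 ^ n.+1)%:R))).
rewrite (@big_cat_nat _ _ _ (2 ^ n)) //=; last by rewrite leq_exp2l.
rewrite -{2}[(2 ^ n)%N]add0n big_addn.
have -> : (2 ^ n.+1 - 2 ^ n)%N = (2 ^ n)%N by rewrite expnS; lia.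
rewrite -big_split big_mkord /=; apply: ler_sum => j _.
(* The second half of the sum is the first half shifted by [1/2]. *)
have -> : t + (j + 2 ^ n)%:R / (2 ^ n.+1)%:R = t + j%:R / (2 ^ n.+1)%:R + 2^-1.
  by rewrite expnS natrD natrM; field.
rewrite log_dist_double // expnS natrM.
by rewrite le_eqVlt; apply/orP; left; apply/eqP; congr log_dist; field.
Qed.

Lemma continuous_normc_affine r w :
  continuous (fun t => normc (r%:C%C * circle_pt t - w)).
Proof.
case: w => a b t /=; apply: continuous_comp; last exact: sqrt_continuous.
have cc : {for t, continuous (fun t => cos (2 * pi * t) : R)}.
  apply: continuous_comp; last exact: continuous_cos.
  exact: mulrl_continuous.
have cs : {for t, continuous (fun t => sin (2 * pi * t) : R)}.
  apply: continuous_comp; last exact: continuous_sin.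
  exact: mulrl_continuous.
have csq (f : R -> R) : {for t, continuous f} ->
    {for t, continuous (fun t => f t ^+ 2)}.
  move=> cf; apply: (@continuous_comp _ _ _ f (fun y => y ^+ 2)) => //.
  exact: exprn_continuous.
have czl (k : R) (f : R -> R) : {for t, continuous f} ->
    {for t, continuous (fun t => k * f t)}.
  by move=> cf; apply: cvgM => //; exact: cvg_cst.
have cu : {for t,
    continuous (fun t => r * cos (2 * pi * t) - 0 * sin (2 * pi * t) - a)}.
  by apply: cvgB; [apply: cvgB; apply: czl | exact: cvg_cst].
have cv : {for t,
    continuous (fun t => r * sin (2 * pi * t) + 0 * cos (2 * pi * t) - b)}.
  by apply: cvgB; [apply: cvgD; apply: czl | exact: cvg_cst].
apply: cvgD; [exact: csq cu | exact: csq cv].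
Qed.

Lemma continuous_log_dist r w : 1 < r -> normc w <= 1 ->
  continuous (log_dist r w).
Proof.
move=> r1 w1 t.
apply: (@continuous_comp _ _ _
  (fun t => normc (r%:C%C * circle_pt t - w)) (@ln R)).
  exact: continuous_normc_affine.
exact/continuous_ln/normc_dilate_gt0.
Qed.

Lemma continuous_normc_prod s :
  continuous (fun t => \prod_(w <- s) normc (circle_pt t - w)).
Proof.
elim: s => [|w s IH] t.
  under [X in continuous_at t X]eq_fun do rewrite big_nil.
  exact: cvg_cst.
under [X in continuous_at t X]eq_fun do rewrite big_cons.
apply: continuousM; last exact: IH.
have := continuous_normc_affine (r := 1) (w := w) (x := t).
by under [X in continuous_at t X -> _]eq_fun do rewrite mul1r.
Qed.

Lemma continuous_sum_log_dist r s : 1 < r -> {in s, forall w, normc w <= 1} ->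
  continuous (fun t => \sum_(w <- s) log_dist r w t).
Proof.
move=> r1; elim: s => [|w s IH] s1 t.
  under [X in continuous_at t X]eq_fun do rewrite big_nil.
  exact: cvg_cst.
under [X in continuous_at t X]eq_fun do rewrite big_cons.
apply: continuousD; last by apply: IH => z zs; apply: s1; rewrite inE zs orbT.
by apply: continuous_log_dist => //; apply: s1; rewrite mem_head.
Qed.

(** Where the product vanishes the left side is [-oo]; elsewhere [normc_dilate_ge] applies to each
    factor. *)
Lemma lne_prod_le r s t : 1 < r -> {in s, forall w, normc w <= 1} ->
  (lne (\prod_(w <- s) normc (circle_pt t - w))%:E
    <= (\sum_(w <- s) log_dist r w t)%:E)%E.
Proof.
move=> r1 s1; have [p0|p0] := lerP (\prod_(w <- s) normc (circle_pt t - w)) 0.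
  by rewrite le0_lneNy ?leNye ?lee_fin.
rewrite lne_EFin // lee_fin.
have [P0 <-] : 0 < \prod_(w <- s) normc (r%:C%C * circle_pt t - w) /\
    ln (\prod_(w <- s) normc (r%:C%C * circle_pt t - w))
      = \sum_(w <- s) log_dist r w t.
  elim: s s1 {p0} => [|w s IH] s1; first by rewrite !big_nil ln1.
  have [|P0 E] := IH; first by move=> z zs; apply: s1; rewrite inE zs orbT.
  have w0 : 0 < normc (r%:C%C * circle_pt t - w).
    by apply: normc_dilate_gt0 => //; apply: s1; rewrite mem_head.
  by rewrite !big_cons mulr_gt0 // lnM ?posrE // E.
rewrite ler_ln ?posrE // big_seq [leRHS]big_seq; apply: ler_prod => w ws.
by rewrite normc_ge0 normc_dilate_ge ?normc_circle_pt ?s1.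
Qed.

Lemma integral_sum_log_dist_le r s n :
  1 < r -> {in s, forall w, normc w <= 1} ->
  (\int[mu]_(t in `[0%R, 1%R]) (\sum_(w <- s) log_dist r w t)%:E
    <= ((size s)%:R * (ln r + (2 ^+ n)^-1))%:E)%E.
Proof.
move=> r1 s1; have n0 : 0 < (2 ^ n)%:R :> R by rewrite ltr0n expn_gt0.
apply: (le_trans (@integral_01_le_average _ _ (2 ^ n)%N
  ((size s)%:R * ln (r ^+ (2 ^ n) + 1)) (continuous_sum_log_dist r1 s1) _ _)).
- by rewrite expn_gt0.
- move=> t; rewrite exchange_big /=.
  apply: (@le_trans _ _ (\sum_(w <- s) ln (r ^+ (2 ^ n) + 1))).
    rewrite big_seq [leRHS]big_seq; apply: ler_sum => w ws.
    by apply: sum_log_dist_le => //; exact: s1.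
  by rewrite big_const_seq count_predT iter_addr_0 mulr_natl.
rewrite lee_fin -mulrA; apply: ler_wpM2l; first by [].
rewrite ler_pdivrMr // mulrDl -natrX mulVf ?gt_eqF //.
have r0 : 0 < r by lra.
have rn1 : 1 <= r ^+ (2 ^ n) by rewrite exprn_ege1 // ltW.
(* This splits into [ln 2] and [2 ^ n * ln r], and [ln 2 <= 1] by [ln (1 + x) <= x] at [x = 1]. *)
apply: (@le_trans _ _ (ln (2 * r ^+ (2 ^ n)))).
  by rewrite ler_ln ?posrE; lra.
rewrite lnM ?posrE ?exprn_gt0 // lnXn // -[ln r *+ _]mulr_natr addrC lerD2l.
by have := @le_ln1Dx R 1; rewrite (_ : 1 + 1 = 2) //; apply; lra.
Qed.

Lemma mahler_le0 (f : laurent) s : {in s, forall w, normc w <= 1} ->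
  (forall t, normc (leval (circle_pt t) f)
    = \prod_(w <- s) normc (circle_pt t - w)) ->
  (mahler R f <= 0)%E.
Proof.
move=> s1 fE; rewrite /mahler.
under eq_integral => t _ do rewrite fE.
pose L : R -> \bar R := fun t =>
  lne (\prod_(w <- s) normc (circle_pt t - w))%:E.
have mL : measurable_fun [set: R]%classic L.
  have mp := continuous_measurable_fun (@continuous_normc_prod s).
  apply: measurable_fun_ifT; first exact: measurable_fun_ler.
    exact: measurable_cst.
  by apply/measurable_EFinP; apply: measurableT_comp.
(* [L] may take the value [-oo], so the integrals are compared through positive and negative parts,
   whose monotonicity asks only for measurability. *)
have le_int r : 1 < r -> (\int[mu]_(t in `[0%R, 1%R]) L t
     <= \int[mu]_(t in `[0%R, 1%R]) (\sum_(w <- s) log_dist r w t)%:E)%E.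
  move=> r1; pose H : R -> \bar R := fun t => (\sum_(w <- s) log_dist r w t)%:E.
  have mH : measurable_fun [set: R]%classic H.
    apply/measurable_EFinP; apply: continuous_measurable_fun.
    exact: continuous_sum_log_dist.
  rewrite integralE [leRHS]integralE; apply: leeB.
    apply: ge0_le_integral => //.
    + by apply: measurable_funepos; apply: measurable_funTS.
    + by apply: measurable_funepos; apply: measurable_funTS.
    + by move=> t /mem_set; apply: funepos_le => x _; exact: lne_prod_le.
  apply: ge0_le_integral => //.
  + by apply: measurable_funeneg; apply: measurable_funTS.
  + by apply: measurable_funeneg; apply: measurable_funTS.
  + by move=> t /mem_set; apply: funeneg_le => x _; exact: lne_prod_le.
apply/lee_addgt0Pr => e e0; rewrite add0e.
pose d : R := (size s)%:R.
have d0 : 0 <= d by [].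
(* With [r = expR e'] and [2 ^- n <= e'], the bound is at most [2 * d * e' <= e]; the [+ 1] covers
   an empty [s]. *)
pose e' := e / (2 * (d + 1)).
have e'0 : 0 < e' by rewrite divr_gt0 // mulr_gt0 //; lra.
have [n [_ n_large]] := exprn_unbounded (e'^-1) (ltr1n R 2).
have r1 : 1 < expR e' by rewrite expR_gt1.
apply: (le_trans (le_int _ r1)).
apply: (le_trans (integral_sum_log_dist_le n r1 s1)).
rewrite lee_fin expRK -/d.
have : (2 ^+ n)^-1 <= e'.
  by rewrite -[leRHS]invrK lef_pV2 ?posrE ?invr_gt0 ?exprn_gt0 // ltW.
have -> : e = 2 * (d + 1) * e' by rewrite /e'; field; rewrite gt_eqF; lra.
by move=> le_e'; nra.
Qed.
End Jensen.

Theorem theorem6p1 (R : realType) (f : laurent)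
  (f_prim : lprimitive f) (f_irr : lirreducible f)
  (f_mahler : (0 < mahler R f)%E) :
  exists m : nat, (0 < m)%N /\ m_good m f.
Proof.
have [l fl] := top_mod0E f_prim.1.
have [fl1|] := eqVneq `|mcoeff l f|%N 1%N; last exact: m_good_of_nonunit_lead.
have nfl : normc ((mcoeff l f)%:~R : R[i]) = 1 by rewrite normc_int -abszE fl1.
have fl0 : (mcoeff l f)%:~R != 0 :> R[i].
  by apply: contra_eq_neq nfl => ->; rewrite normc0 eq_sym oner_eq0.
have [N [s fE]] := leval_factor fl fl0.
(* Either some root lies outside the closed unit disc, or Jensen's bound contradicts [f_mahler]. *)
have [/hasP[w ws w1]|no_root] := boolP (has (fun w => 1 < normc w) s).
  apply: (m_good_of_root w1); rewrite fE; last first.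
    by apply: contraTneq w1 => ->; rewrite normc0 -leNgt.
  by rewrite (big_rem _ ws) /= subrr mul0r mulr0.
suff : (mahler R f <= 0)%E by rewrite leNgt f_mahler.
apply: (@mahler_le0 _ _ s) => [w ws|t].
  by rewrite leNgt; apply: contra no_root => w1; apply/hasP; exists w.
have ct0 : circle_pt t != 0 :> R[i].
  apply: contra_eq_neq (normc_circle_pt t) => ->.
  by rewrite normc0 eq_sym oner_eq0.
(* On the circle both the leading coefficient and the power of the variable have modulus [1]. *)
rewrite fE // !normcM nfl normcXz normc_circle_pt exp1rz !mul1r.
by apply: (big_morph (@normc R)); [exact: normcM | exact: normc1].
Qed.
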